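(* For all positive integers $m,n$ with $3\mid mn$, $$N_T(m,n)\le 2^{\frac{4mn}{3}}\,\min\{N_D(m,2n),\,N_D(2m,n)\}.$$
   Context: $R(m,n)$ denotes the rectangle with $m$ rows and $n$ columns of unit squares. A tromino is an L-shaped tromino, i.e. a $2\times 2$ block of unit squares with one unit square removed, in any of its four orientations. A domino is a pair of unit squares sharing an edge. A tromino (domino) tiling of $R(m,n)$ is a partition of its unit squares into trominoes (dominoes). $N_T(m,n)$ denotes the number of tromino tilings of $R(m,n)$, and $N_D(m,n)$ denotes the number of domino tilings of $R(m,n)$. For reference, by a known result of Fisher–Temperley and Kasteleyn, $N_D(2m,2n)=4^{mn}\prod_{j=1}^{m}\prod_{k=1}^{n}\left(\cos^2\frac{j\pi}{2m+1}+\cos^2\frac{k\pi}{2n+1}\right)$. *)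

(* Defs.v *)
From mathcomp Require Import all_boot.
Set Implicit Arguments.
Unset Strict Implicit.
Unset Printing Implicit Defensive.

(* The unit squares of an m x n rectangle: the one in row i and column j is (i, j), counted from 0. *)
Definition square (m n : nat) : finType := ('I_m * 'I_n)%type.

(* The 2 x 2 block with top-left square (i, j); it fits in the rectangle
   only when i.+1 < m and j.+1 < n. *)
Definition block (m n i j : nat) : {set square m n} :=
  [set c : square m n | (i <= c.1 <= i.+1) && (j <= c.2 <= j.+1)].

Definition is_tromino (m n : nat) (A : {set square m n}) : bool :=
  [exists i : 'I_m, exists j : 'I_n,
    [&& i.+1 < m, j.+1 < n &
        [exists c in block m n i j, A == block m n i j :\ c]]].

Definition share_edge (m n : nat) (a b : square m n) : bool :=
  ((a.1 == b.1) && ((a.2.+1 == b.2 :> nat) || (b.2.+1 == a.2 :> nat))) ||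
  ((a.2 == b.2) && ((a.1.+1 == b.1 :> nat) || (b.1.+1 == a.1 :> nat))).

Definition is_domino (m n : nat) (A : {set square m n}) : bool :=
  [exists a : square m n, exists b : square m n,
    share_edge a b && (A == [set a; b])].

Definition tilings (m n : nat) (tile : pred {set square m n}) :
    {set {set {set square m n}}} :=
  [set P : {set {set square m n}} |
    partition P [set: square m n] && [forall A in P, tile A]].

Definition N_T (m n : nat) : nat := #|tilings (@is_tromino m n)|.

Definition N_D (m n : nat) : nat := #|tilings (@is_domino m n)|.

(* Main.v *)
Require Import Defs.
From mathcomp Require Import all_boot.
From mathcomp Require Import zify.
Set Implicit Arguments.
Unset Strict Implicit.
Unset Printing Implicit Defensive.

(** The factor [2 ^ (4mn/3)] is [16 ^ k], where [k = mn/3] is the number of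
    trominoes in a tiling, and this factor alone already bounds [N_T m n].

    A tromino through a given square is determined by the position of that
    square in the surrounding 2 x 2 block and by the square which is removed
    from the block, so at most [4 * 4 = 16] trominoes contain a given square
    ([card_trominoes_through]).  Build a tiling by repeatedly fixing an
    uncovered square and choosing the tile that covers it: there are [k] steps
    with at most 16 choices each, whence [N_T m n <= 16 ^ k].  This works for
    any tiles of a common size with boundedly many through each point
    ([card_partitions_by_tiles]).

    Doubling one side of the rectangle makes it even, and a rectangle with an
    even side has a domino tiling, with all dominoes parallel to that side.
    Hence the minimum of the two domino counts is at least 1. *)

(** Sort the tilings of [A] by the tile [B] that covers a fixed [x] in [A]:
    there are at most [K] values of [B], and removing [B] leaves a tiling of
    [A :\: B] by [k.-1] tiles. *)
Lemma card_partitions_by_tiles (T : finType) (tile : pred {set T}) (s K : nat) :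
    0 < s -> (forall B, tile B -> #|B| = s) ->
    (forall x, #|[set B | tile B & x \in B]| <= K) ->
  forall k (A : {set T}), #|A| = s * k ->
    #|[set P | partition P A && [forall B in P, tile B]]| <= K ^ k.
Proof.
move=> s_gt0 card_tile tiles_through; elim=> [|k IHk] A cardA.
  have /eqP -> : A == set0 by rewrite -cards_eq0 cardA muln0.
  rewrite expn0 -(cards1 (set0 : {set {set T}})).
  apply/subset_leq_card/subsetP => P.
  by rewrite !inE partition_set0 => /andP[].
have /card_gt0P[x Ax] : 0 < #|A| by rewrite cardA muln_gt0 s_gt0.
set tilingsA := [set P | _].
have tilingsAP P : P \in tilingsA ->
    [/\ partition P A, pblock P x \in P & forall B, B \in P -> tile B].
  rewrite inE => /andP[partP /forall_inP tileP]; split=> //.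
  by rewrite pblock_mem // (cover_partition partP).
rewrite -sum1_card (partition_big (fun P => pblock P x)
    [in [set B | tile B & x \in B]]) /=; last first.
  move=> P /tilingsAP[partP PxP tileP].
  by rewrite inE tileP // mem_pblock (cover_partition partP).
rewrite expnS; apply: leq_trans (leq_mul (tiles_through x) (leqnn _)).
rewrite -sum_nat_const; apply: leq_sum => B; rewrite inE => /andP[tileB xB].
rewrite sum1dep_card; set F := [set P | _].
have FP P : P \in F -> [/\ partition P A, B \in P & forall C, C \in P -> tile C].
  by rewrite inE => /andP[/tilingsAP[? PxP ?] /eqP <-].
have [-> | [P0 /FP[partP0 BP0 _]]] := set_0Vmem F; first by rewrite cards0.
have subBA : B \subset A.
  by rewrite -(cover_partition partP0) (bigcup_max B).
(* Putting [B] back recovers the tiling, so [P |-> P :\ B] is injective. *)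
have injF : {in F &, injective (fun P => P :\ B)}.
  move=> P Q /FP[_ BP _] /FP[_ BQ _] eqPQ.
  by rewrite -(setD1K BP) -(setD1K BQ) eqPQ.
rewrite -(card_in_imset injF).
apply: leq_trans (IHk (A :\: B) _); last first.
  by rewrite cardsDS // cardA card_tile // mulnS addKn.
apply/subset_leq_card/subsetP => _ /imsetP[P /FP[partP BP tileP] ->].
rewrite inE partitionD1 //=.
by apply/forall_inP => C /setD1P[_ /tileP].
Qed.

Lemma card_block (m n i j : nat) : i.+1 < m -> j.+1 < n -> #|block m n i j| = 4.
Proof.
move=> lt_im lt_jn.
pose rows := [set Ordinal (ltnW lt_im); Ordinal lt_im].
pose cols := [set Ordinal (ltnW lt_jn); Ordinal lt_jn].
have -> : block m n i j = setX rows cols.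
  by apply/setP => -[a b]; rewrite !inE -!val_eqE /=; lia.
by rewrite cardsX !cards2 -!val_eqE /=; lia.
Qed.

Lemma card_tromino (m n : nat) (A : {set square m n}) : is_tromino A -> #|A| = 3.
Proof.
case/existsP => i /existsP[j /and3P[lt_im lt_jn /exists_inP[c cB /eqP ->]]].
by have := cardsD1 c (block m n i j); rewrite cB card_block // => -[].
Qed.

(** Each tromino through [x] is coded by four bits: the offset of [x] in the
    2 x 2 block and the offset of the removed square. *)
Lemma card_trominoes_through (m n : nat) (x : square m n) :
  #|[set A | is_tromino A & x \in A]| <= 16.
Proof.
pose decode (u : (bool * bool) * (bool * bool)) : {set square m n} :=
  let i := x.1 - u.1.1 in let j := x.2 - u.1.2 in
  [set z in block m n i j | ~~ ((z.1 == i + u.2.1 :> nat) &&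
                                (z.2 == j + u.2.2 :> nat))].
have <- : #|[set: (bool * bool) * (bool * bool)]| = 16.
  by rewrite cardsT !card_prod card_bool.
apply: leq_trans (leq_imset_card decode _).
apply/subset_leq_card/subsetP => A; rewrite inE => /andP[].
case/existsP => i /existsP[j /and3P[_ _ /exists_inP[c cB /eqP ->]]].
case/setD1P => _ xB; move: cB xB; rewrite !inE => cB xB.
apply/imsetP; exists ((i < x.1, j < x.2), (i < c.1, j < c.2)); first by [].
have ei : x.1 - (i < x.1) = i by lia.
have ej : x.2 - (j < x.2) = j by lia.
have ec1 : i + (i < c.1) = c.1 by lia.
have ec2 : j + (j < c.2) = c.2 by lia.
rewrite /decode /= ei ej ec1 ec2; apply/setP => z.
by rewrite !inE !val_eqE -pair_eqE andbC.
Qed.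

(** Rounding down to [j./2] cuts [0, 2n) into pairs of consecutive numbers. *)
Lemma same_half_pair (n : nat) (j : 'I_(2 * n)) :
  exists2 k : 'I_(2 * n), (j.+1 == k :> nat) || (k.+1 == j :> nat) &
    forall z : 'I_(2 * n), (j./2 == z./2) = (z == j) || (z == k).
Proof.
have lt_j := ltn_ord j.
have lt_k : (if odd j then j.-1 else j.+1) < 2 * n by case: ifP; lia.
exists (Ordinal lt_k) => [/=|z]; rewrite -?val_eqE /=; case: ifP => odd_j; lia.
Qed.

(** The fibres of [f] are the dominoes. *)
Lemma N_D_gt0_fibres (m n : nat) (T : eqType) (f : square m n -> T) :
    (forall a, exists2 b, share_edge a b &
       forall z, (f a == f z) = (z == a) || (z == b)) ->
  0 < N_D m n.
Proof.
move=> fibre; apply/card_gt0P; exists (preim_partition f [set: square m n]).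
rewrite inE preim_partitionP; apply/forall_inP => _ /imsetP[a _ ->].
have [b ab fab] := fibre a.
apply/existsP; exists a; apply/existsP; exists b; rewrite ab /=.
by apply/eqP/setP => z; rewrite !inE fab.
Qed.

Lemma N_D_gt0_even_width (m n : nat) : 0 < N_D m (2 * n).
Proof.
apply: (@N_D_gt0_fibres _ _ _ (fun c => (c.1, (c.2 : nat)./2))) => -[i j].
have [k jk half_k] := same_half_pair j.
exists (i, k) => [|[i' z]]; first by rewrite /share_edge /= eqxx jk.
by rewrite !xpair_eqE half_k andb_orr [i' == i]eq_sym.
Qed.

Lemma N_D_gt0_even_height (m n : nat) : 0 < N_D (2 * m) n.
Proof.
apply: (@N_D_gt0_fibres _ _ _ (fun c => ((c.1 : nat)./2, c.2))) => -[i j].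
have [k ik half_k] := same_half_pair i.
exists (k, j) => [|[z j']]; first by rewrite /share_edge /= eqxx ik orbT.
by rewrite !xpair_eqE half_k andb_orl [j' == j]eq_sym.
Qed.

Theorem theorem8 (m n : nat) (hm : 0 < m) (hn : 0 < n) (hmn : 3 %| m * n) :
  N_T m n <= 2 ^ ((4 * m * n) %/ 3) * minn (N_D m (2 * n)) (N_D (2 * m) n).
Proof.
have min_gt0 : 0 < minn (N_D m (2 * n)) (N_D (2 * m) n).
  by rewrite leq_min N_D_gt0_even_width N_D_gt0_even_height.
apply: leq_trans (leq_pmulr _ min_gt0).
rewrite -mulnA -muln_divA // expnM.
apply: (card_partitions_by_tiles (s := 3)) => //.
- exact: card_tromino.
- exact: card_trominoes_through.
- by rewrite cardsT card_prod !card_ord [RHS]mulnC divnK.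
Qed.
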